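(* Let $A$ be a Banach algebra. Then the following statements hold. (i) If $A$ is cyclically weakly amenable, then $A$ is essential. (ii) If $A^{**}$ is cyclically weakly amenable, then $A$ is essential.
   Context: Let $A$ be a complex Banach algebra with dual $A^*$. For $F\in A^*$ and $a,b\in A$ put $\langle F\cdot a,b\rangle=\langle F,ab\rangle$ and $\langle a\cdot F,b\rangle=\langle F,ba\rangle$. A linear operator $D:A\to A^*$ is a derivation if $D(ab)=D(a)\cdot b+a\cdot D(b)$ for all $a,b\in A$; it is cyclic if $\langle D(a),b\rangle+\langle D(b),a\rangle=0$ for all $a,b\in A$. $A$ is cyclically weakly amenable if every continuous derivation from $A$ into $A^*$ is cyclic. $A$ is essential if $A^2$ (the linear span of all products $ab$, $a,b\in A$) is dense in $A$. The second dual $A^{**}$ is regarded as a Banach algebra with the first Arens product: $\langle\Phi\Psi,F\rangle=\langle\Phi,\Psi\vartriangle F\rangle$, where $\langle\Psi\vartriangle F,a\rangle=\langle\Psi,F\cdot a\rangle$ for $\Phi,\Psi\in A^{**}$, $F\in A^*$, $a\in A$. *)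

(* Defs.v *)
From HB Require Import structures.
From mathcomp Require Import all_boot all_order all_algebra.
From mathcomp Require Import all_classical all_reals.
From mathcomp Require Import topology normedtype.
From mathcomp.real_closed Require Export complex.
Set Implicit Arguments.
Unset Strict Implicit.
Unset Printing Implicit Defensive.
Import Order.TTheory GRing.Theory Num.Theory numFieldNormedType.Exports.
Local Open Scope classical_set_scope.
Local Open Scope ring_scope.
Local Open Scope complex_scope.

(** Banach algebras need not be unital, whereas the rings and algebras of
    MathComp are, hence a separate multiplication [x ** y]. *)

HB.mixin Record CompleteNormedModule_isBanachAlgebra (K : numFieldType) A
    & CompleteNormedModule K A := {
  bmul : A -> A -> A;
  bmulA : associative bmul;
  bmulDl : left_distributive bmul +%R;
  bmulDr : right_distributive bmul +%R;
  bscaleAl : forall (k : K) x y, k *: bmul x y = bmul (k *: x) y;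
  bscaleAr : forall (k : K) x y, k *: bmul x y = bmul x (k *: y);
  ler_normbM : forall x y, `|bmul x y| <= `|x| * `|y|
}.

#[short(type="banachAlgType")]
HB.structure Definition BanachAlgebra (K : numFieldType) :=
  {A of CompleteNormedModule K A & CompleteNormedModule_isBanachAlgebra K A}.

Reserved Notation "x ** y" (at level 40, left associativity).
Notation "x ** y" := (bmul x y) : ring_scope.

(** The scalar field [R[i]] is a normed module over itself as [R[i]^o]. *)

Section ComplexField.
Context (R : realType).
Local Notation C := R[i].

Lemma Re_norm_le (z : C) : `|complex.Re z|%:C <= `|z|.
Proof. exact: normc_ge_Re. Qed.

Lemma Im_norm_le (z : C) : `|complex.Im z|%:C <= `|z|.
Proof.
case: z => a b /=; rewrite normc_def lecR /=.
by rewrite -sqrtr_sqr ler_wsqrtr// lerDr sqr_ge0.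
Qed.

Lemma norm_le_ReIm (z : C) :
  `|z| <= (`|complex.Re z| + `|complex.Im z|)%:C.
Proof.
rewrite {1}[z]complexE (le_trans (ler_normD _ _))// normrM.
rewrite !normc_def /= !expr0n !expr1n /= !addr0 add0r sqrtr1 mul1r !sqrtr_sqr.
by rewrite -rmorphD.
Qed.

Lemma normC_Re (z : C) : (complex.Re `|z|)%:C = `|z|.
Proof. by rewrite RRe_real// normr_real. Qed.

Lemma cauchy_norm (K : numFieldType) (V : normedModType K)
    (F : set_system V) (e : K) : ProperFilter F -> cauchy F -> 0 < e ->
  exists x, F [set y | `|x - y| < e].
Proof. by move=> FF /cauchyP Fc /Fc[x]; rewrite -ball_normE; exists x. Qed.

Lemma C_complete (F : set_system C^o) :
  ProperFilter F -> cauchy F -> cvg F.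
Proof.
move=> FF Fc.
have cvgP (p : C -> R) : {morph p : x y / x - y} ->
    (forall z, `|p z|%:C <= `|z|) -> cvg (p @ F).
  move=> pB ple; apply: (@R_complete R); apply: cauchy_exP => e e0.
  have eC : 0 < e%:C :> C by rewrite ltcR.
  have [x Fx] := cauchy_norm FF Fc eC; exists (p x).
  rewrite -ball_normE /= nbhs_simpl /=; apply: filterS Fx => y /= xy.
  by rewrite -pB -ltcR (le_lt_trans (ple _)).
have /cvg_ex[a /cvgrPdist_lt Fa] :
    cvg (@complex.Re R @ F).
  by apply: cvgP => [[? ?] [? ?]//|]; exact: Re_norm_le.
have /cvg_ex[b /cvgrPdist_lt Fb] :
    cvg (@complex.Im R @ F).
  by apply: cvgP => [[? ?] [? ?]//|]; exact: Im_norm_le.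
apply/cvg_ex; exists (a +i* b); apply/cvgrPdist_lt => e e0.
have eE : (complex.Re e)%:C = e by rewrite RRe_real// gtr0_real.
have e20 : 0 < complex.Re e / 2 by rewrite divr_gt0// -ltcR eE.
have {}Fa := Fa _ e20; have {}Fb := Fb _ e20.
near=> z; rewrite (le_lt_trans (norm_le_ReIm _))// -eE ltcR.
have -> : complex.Re (a +i* b - z) = a - complex.Re z by case: (z).
have -> : complex.Im (a +i* b - z) = b - complex.Im z by case: (z).
by rewrite [ltRHS]splitr ltrD//; near: z.
Unshelve. all: by end_near. Qed.

End ComplexField.

(** The dual consists of the continuous linear functionals. The operator norm is
    a real supremum embedded in [R[i]], where norms of [R[i]]-modules live. *)

Section Dual.
Context (R : realType) (V : normedModType R[i]).
Local Notation C := R[i].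

Definition cont_functional : {pred V -> C^o} :=
  mem [set f : V -> C^o | linear f /\ continuous f].

Record dual := Dual { dual_val : V -> C^o; _ : dual_val \in cont_functional }.

HB.instance Definition _ := [isSub for dual_val].
HB.instance Definition _ := [Choice of dual by <:].

Lemma cont_functional_submod_closed : submod_closed cont_functional.
Proof.
split=> [|a f g].
  apply/mem_set; split=> [k x y|x]; last exact: cvg_cst.
  by rewrite scaler0 addr0.
move=> /set_mem[fl fc] /set_mem[gl gc]; apply/mem_set; split=> [k x y|x].
  rewrite !fctE fl gl !scalerDr !scalerA [k * a]mulrC.
  by rewrite -!addrA; congr (_ + _); rewrite addrCA.
by apply: cvgD; [apply: cvgZr; exact: fc|exact: gc].
Qed.

HB.instance Definition _ := GRing.isSubmodClosed.Build _ _ cont_functional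
  cont_functional_submod_closed.
HB.instance Definition _ := [SubChoice_isSubLmodule of dual by <:].

Definition dual_fun (f : dual) : V -> C^o := dual_val f.
Coercion dual_fun : dual >-> Funclass.

Fact dual_linear (f : dual) : linear f.
Proof. by case: f => f fP; case: (set_mem fP). Qed.

HB.instance Definition _ (f : dual) :=
  GRing.isLinear.Build _ _ _ _ f (@dual_linear f).

Lemma dual_continuous (f : dual) : continuous f.
Proof. by case: f => f fP; case: (set_mem fP). Qed.

Lemma dualP (f g : dual) : f =1 g -> f = g.
Proof. by move=> fg; apply/val_inj/funext. Qed.

Lemma dual0E x : (0 : dual) x = 0. Proof. by []. Qed.
Lemma dualDE (f g : dual) x : (f + g) x = f x + g x. Proof. by []. Qed.
Lemma dualNE (f : dual) x : (- f) x = - f x. Proof. by []. Qed.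
Lemma dualBE (f g : dual) x : (f - g) x = f x - g x. Proof. by []. Qed.
Lemma dualZE (k : C) (f : dual) x : (k *: f) x = k *: f x. Proof. by []. Qed.

Definition opnorm (f : dual) : C :=
  (sup [set complex.Re `|f x| | x in [set x | `|x| <= 1]])%:C.

Lemma dual_bounded (f : dual) : exists2 M : C, 0 < M &
  forall x, `|f x| <= M * `|x|.
Proof.
have /linear_bounded_continuous/linear_boundedP := @dual_continuous f.
by move=> /pinfty_ex_gt0[M M0 fM]; exists M.
Qed.

Lemma opnorm_has_sup (f : dual) :
  has_sup [set complex.Re `|f x| | x in [set x | `|x| <= 1]].
Proof.
split; first by exists (complex.Re `|f 0|), 0 => //=; rewrite normr0.
have [M M0 fM] := dual_bounded f.
exists (complex.Re M) => _ [x /= x1 <-].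
rewrite -lecR normC_Re RRe_real ?gtr0_real// (le_trans (fM x))//.
by rewrite ler_piMr// ltW.
Qed.

Lemma opnorm_ge0 (f : dual) : 0 <= opnorm f.
Proof.
have f0 : 0 <= complex.Re `|f 0| by rewrite -lecR normC_Re; exact: normr_ge0.
rewrite lecR; apply: (le_trans f0); apply: (ub_le_sup (opnorm_has_sup f).2).
by exists 0 => //=; rewrite normr0.
Qed.

Lemma le_opnorm (f : dual) x : `|f x| <= opnorm f * `|x|.
Proof.
have [->|x0] := eqVneq x 0; first by rewrite linear0 !normr0 mulr0.
have nx0 : 0 < `|x| by rewrite normr_gt0.
rewrite -ler_pdivrMr// mulrC -[X in X * _]ger0_norm ?invr_ge0//.
rewrite -[leLHS](@normrZ _ C^o) -linearZ -normC_Re lecR.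
apply: (ub_le_sup (opnorm_has_sup f).2); exists (`|x|^-1 *: x) => //=.
by rewrite normrZ ger0_norm ?invr_ge0// mulVf ?lt0r_neq0.
Qed.

Lemma opnorm_le (f : dual) (M : C) : 0 <= M ->
  (forall x, `|f x| <= M * `|x|) -> opnorm f <= M.
Proof.
move=> M0 fM; have ME : (complex.Re M)%:C = M by rewrite RRe_real// ger0_real.
rewrite /opnorm -ME lecR ge_sup//; first exact: (opnorm_has_sup f).1.
move=> _ [x /= x1 <-]; rewrite -lecR normC_Re ME (le_trans (fM x))//.
by rewrite ler_piMr.
Qed.

Lemma opnormD (f g : dual) : opnorm (f + g) <= opnorm f + opnorm g.
Proof.
apply: opnorm_le => [|x]; first by rewrite addr_ge0// opnorm_ge0.
by rewrite dualDE (le_trans (ler_normD _ _))// mulrDl lerD// le_opnorm.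
Qed.

Lemma opnormZ (k : C) (f : dual) : opnorm (k *: f) = `|k| * opnorm f.
Proof.
have leZ (l : C) (g : dual) : opnorm (l *: g) <= `|l| * opnorm g.
  apply: opnorm_le => [|x]; first by rewrite mulr_ge0// opnorm_ge0.
  by rewrite dualZE normrZ -mulrA ler_wpM2l// le_opnorm.
apply/le_anti; rewrite leZ /=.
have [->|k0] := eqVneq k 0; first by rewrite normr0 mul0r opnorm_ge0.
rewrite -ler_pdivlMl ?normr_gt0// -normfV.
by rewrite -{1}[f](scalerK k0) leZ.
Qed.

Lemma opnorm0_eq0 (f : dual) : opnorm f = 0 -> f = 0.
Proof.
move=> f0; apply: dualP => x; apply/eqP; rewrite dual0E -normr_le0.
by rewrite (le_trans (le_opnorm f x))// f0 mul0r.
Qed.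

HB.instance Definition _ :=
  Lmodule_isNormed.Build C dual opnormD opnormZ opnorm0_eq0.

Lemma ler_dual (f : dual) x : `|f x| <= `|f| * `|x|.
Proof. exact: le_opnorm. Qed.

Lemma dual_norm_le (f : dual) (M : C) : 0 <= M ->
  (forall x, `|f x| <= M * `|x|) -> `|f| <= M.
Proof. exact: opnorm_le. Qed.

(** A dual element from a linear map with a bound [M] witnessing continuity. *)
Section mkDual.
Variables (f : V -> C^o) (fl : linear f) (M : C).
Hypothesis fM : forall x, `|f x| <= M * `|x|.

Fact mkdual_subproof : f \in cont_functional.
Proof.
apply/mem_set; split=> //.
pose L := GRing.isLinear.Build _ _ _ _ f fl.
pose g : {linear V -> C^o} := HB.pack f L.
apply: (@bounded_linear_continuous _ _ _ g); apply/bounded_funP => r.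
exists (`|M| * r) => x xr; rewrite (le_trans (fM x))//.
rewrite (le_trans (real_ler_norm _))//; last by rewrite normrM normr_id ler_wpM2l.
by rewrite ger0_real// (le_trans _ (fM x)).
Qed.

Definition mkdual : dual := Dual mkdual_subproof.

Lemma mkdualE x : mkdual x = f x. Proof. by []. Qed.

End mkDual.

Lemma dual_complete (F : set_system dual) :
  ProperFilter F -> cauchy F -> cvg F.
Proof.
move=> FF Fc.
have Fcvg x : cvg ((fun f : dual => f x) @ F).
  apply: C_complete; apply: cauchy_exP => e e0.
  have x0 : 0 < `|x| + 1 by rewrite ltr_wpDl.
  have [f Ff] := cauchy_norm FF Fc (divr_gt0 e0 x0); exists (f x).
  rewrite -ball_normE /= nbhs_simpl /=; apply: filterS Ff => g /= fg.
  rewrite -dualBE (le_lt_trans (ler_dual _ _))//.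
  have [->|xn0] := eqVneq `|x| 0; first by rewrite mulr0.
  rewrite (@lt_trans _ _ (e / (`|x| + 1) * `|x|))//.
    by rewrite ltr_pM2r// lt0r xn0 /=.
  by rewrite -mulrA gtr_pMr// mulrC ltr_pdivrMr// mul1r ltrDl.
pose l x : C^o := lim ((fun f : dual => f x) @ F).
have lE x : (fun f : dual => f x) @ F --> l x by exact: Fcvg.
have ll : linear l.
  move=> k x y; apply: (@cvg_lim _ (@norm_hausdorff _ _)).
  rewrite (_ : (fun f : dual => _) = (fun f => k *: f x + f y)); last first.
    by apply/funext => f; rewrite linearP.
  by apply: cvgD; [apply: cvgZr; exact: lE|exact: lE].
have key (e : C) : 0 < e -> exists2 f : dual, F [set g | `|f - g| < e] &
    forall x, `|f x - l x| <= e * `|x|.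
  move=> e0; have [f Ff] := cauchy_norm FF Fc e0; exists f => // x.
  apply/ler_addgt0Pr => d d0; have /cvgrPdist_lt/(_ _ d0) ld := lE x.
  near F => g.
  have fg : `|f - g| < e by near: g.
  rewrite -(subrKA (g x)) (le_trans (ler_normD _ _))// lerD//.
    by rewrite -dualBE (le_trans (ler_dual _ _))// ler_wpM2r// ltW.
  by rewrite distrC ltW//; near: g.
have [f0 _ f0l] := key _ ltr01.
have lM x : `|l x| <= (`|f0| + 1) * `|x|.
  rewrite -[l x](subKr (f0 x)) (le_trans (ler_normB _ _))// mulrDl.
  by rewrite lerD// ler_dual.
apply/cvg_ex; exists (mkdual ll lM); apply/cvgrPdist_le => e e0.
have e20 : 0 < e / 2 by rewrite divr_gt0.
have [f Ff fl] := key _ e20.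
near=> g; rewrite -(subrKA f) (le_trans (ler_normD _ _))//.
rewrite [leRHS]splitr lerD//.
  apply: dual_norm_le => [|x]; first by rewrite divr_ge0// ltW.
  by rewrite dualBE mkdualE distrC fl.
by apply: ltW; near: g.
Unshelve. all: by end_near. Qed.

HB.instance Definition _ := Uniform_isComplete.Build dual dual_complete.

End Dual.

Section Arens.
Context (R : realType) (A : banachAlgType R[i]).
Local Notation C := R[i].
Implicit Types (a b : A) (F : dual A) (Phi Psi : dual (dual A)).

Fact dual_actr_linear F a : linear (fun b => F (a ** b)).
Proof. by move=> k x y; rewrite bmulDr -bscaleAr linearP. Qed.

Fact dual_actr_bound F a b : `|F (a ** b)| <= `|F| * `|a| * `|b|.
Proof.
by rewrite (le_trans (ler_dual _ _))// -mulrA ler_wpM2l// ler_normbM.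
Qed.

(** [dual_actr F a] is F.a, i.e. b |-> F(ab), and [dual_actl a F] is a.F,
    i.e. b |-> F(ba). *)
Definition dual_actr F a : dual A :=
  mkdual (dual_actr_linear F a) (dual_actr_bound F a).

Fact dual_actl_linear a F : linear (fun b => F (b ** a)).
Proof. by move=> k x y; rewrite bmulDl -bscaleAl linearP. Qed.

Fact dual_actl_bound a F b : `|F (b ** a)| <= `|F| * `|a| * `|b|.
Proof.
rewrite (le_trans (ler_dual _ _))// -mulrA ler_wpM2l//.
by rewrite [leRHS]mulrC ler_normbM.
Qed.

Definition dual_actl a F : dual A :=
  mkdual (dual_actl_linear a F) (dual_actl_bound a F).

Lemma dual_actr_norm F a : `|dual_actr F a| <= `|F| * `|a|.
Proof.
by apply: dual_norm_le => [|b]; [rewrite mulr_ge0|exact: dual_actr_bound].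
Qed.

(** [arens_act Psi F] is the functional a |-> Psi(F.a) occurring in the first
    Arens product (Phi Psi)(F) = Phi(a |-> Psi(F.a)). *)
Fact arens_act_linear Psi F : linear (fun a => Psi (dual_actr F a)).
Proof.
move=> k x y; rewrite -linearP; congr (Psi _); apply: dualP => b.
by rewrite dualDE dualZE !mkdualE bmulDl -bscaleAl linearP.
Qed.

Fact arens_act_bound Psi F a :
  `|Psi (dual_actr F a)| <= `|Psi| * `|F| * `|a|.
Proof.
by rewrite (le_trans (ler_dual _ _))// -mulrA ler_wpM2l// dual_actr_norm.
Qed.

Definition arens_act Psi F : dual A :=
  mkdual (arens_act_linear Psi F) (arens_act_bound Psi F).

Lemma arens_act_norm Psi F : `|arens_act Psi F| <= `|Psi| * `|F|.
Proof.
by apply: dual_norm_le => [|a]; [rewrite mulr_ge0|exact: arens_act_bound].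
Qed.

Fact arens_mul_linear Phi Psi : linear (fun F => Phi (arens_act Psi F)).
Proof.
move=> k F G; rewrite -linearP; congr (Phi _); apply: dualP => a.
rewrite dualDE dualZE !mkdualE -linearP; congr (Psi _); apply: dualP => b.
by rewrite dualDE dualZE !mkdualE.
Qed.

Fact arens_mul_bound Phi Psi F :
  `|Phi (arens_act Psi F)| <= `|Phi| * `|Psi| * `|F|.
Proof.
by rewrite (le_trans (ler_dual _ _))// -mulrA ler_wpM2l// arens_act_norm.
Qed.

Definition arens_mul Phi Psi : dual (dual A) :=
  mkdual (arens_mul_linear Phi Psi) (arens_mul_bound Phi Psi).

Fact arens_mulA : associative arens_mul.
Proof.
move=> Phi Psi Xi; apply: dualP => F; rewrite !mkdualE; congr (Phi _).
apply: dualP => a; rewrite !mkdualE; congr (Psi _).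
apply: dualP => b; rewrite !mkdualE; congr (Xi _).
by apply: dualP => c; rewrite !mkdualE bmulA.
Qed.

Fact arens_mulDl : left_distributive arens_mul +%R.
Proof. by move=> Phi Psi Xi; apply: dualP => F. Qed.

Fact arens_mulDr : right_distributive arens_mul +%R.
Proof.
move=> Phi Psi Xi; apply: dualP => F; rewrite dualDE !mkdualE -linearD.
by congr (Phi _); apply: dualP => a.
Qed.

Fact arens_scaleAl (k : C) Phi Psi :
  k *: arens_mul Phi Psi = arens_mul (k *: Phi) Psi.
Proof. exact: dualP. Qed.

Fact arens_scaleAr (k : C) Phi Psi :
  k *: arens_mul Phi Psi = arens_mul Phi (k *: Psi).
Proof.
apply: dualP => F; rewrite dualZE !mkdualE -linearZ.
by congr (Phi _); apply: dualP => a.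
Qed.

Fact arens_normM Phi Psi : `|arens_mul Phi Psi| <= `|Phi| * `|Psi|.
Proof.
by apply: dual_norm_le => [|F]; [rewrite mulr_ge0|exact: arens_mul_bound].
Qed.

(** A separate name for [dual (dual A)], carrying the first Arens product. *)
Definition bidual : Type := dual (dual A).

HB.instance Definition _ := CompleteNormedModule.on bidual.
HB.instance Definition _ :=
  CompleteNormedModule_isBanachAlgebra.Build C bidual arens_mulA
    arens_mulDl arens_mulDr arens_scaleAl arens_scaleAr arens_normM.

End Arens.

Section CyclicWeakAmenability.
Context (R : realType) (A : banachAlgType R[i]).

Definition derivation (D : {linear A -> dual A}) :=
  forall a b, D (a ** b) = dual_actr (D a) b + dual_actl a (D b).

Definition cyclic (D : {linear A -> dual A}) :=
  forall a b, D a b + D b a = 0.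

Definition cyclically_weakly_amenable :=
  forall D : {linear A -> dual A}, continuous D -> derivation D -> cyclic D.

(** A^2 is the linear span of the products, not just the set of products. *)
Definition square : set A :=
  [set x | exists n (c : 'I_n -> R[i]) (a b : 'I_n -> A),
     x = \sum_(i < n) c i *: (a i ** b i)].

Definition essential := dense square.

End CyclicWeakAmenability.

Arguments cyclically_weakly_amenable {R} A.
Arguments essential {R} A.

(* Main.v *)
Require Import Defs.
From HB Require Import structures.
From mathcomp Require Import all_boot all_order all_algebra.
From mathcomp Require Import all_classical all_reals.
From mathcomp Require Import topology normedtype.
From mathcomp Require Import ring lra.

(** Suppose that [F] in the dual of [A] vanishes on all products and consider
    the rank-one operator [D a = F a *: F]. Both sides of the Leibniz rule for
    [D] vanish, so [D] is a continuous derivation; if it is cyclic, then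
    [2 * F a ^ 2 = 0] for every [a], hence [F = 0]
    ([cyclically_weakly_amenable_annihilator]). Thus in a cyclically weakly
    amenable algebra no nonzero functional annihilates the products, and by the
    Hahn-Banach theorem the span of the products is then dense
    ([essential_of_annihilator]).

    For the second dual, let [F] vanish on the products of [A]. Then [F.a = 0]
    for every [a], so [(Phi Psi)(F) = 0] for all [Phi] and [Psi]: evaluation at
    [F] is a functional on the second dual that vanishes on its products. If the
    second dual is cyclically weakly amenable, this evaluation is zero, and
    testing it on the evaluations at points of [A] gives [F = 0].

    The separation form of the Hahn-Banach theorem that is needed,
    [dense_of_dual_separation], is proved through sublinear functionals only: by
    Zorn's lemma there is a minimal sublinear functional below a given one, and
    minimality forces it to be linear. This is applied to the distance to the
    subspace, over the reals, and the real functional [f] so obtained is turned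
    into the complex functional [x |-> f x - i f (i x)]. *)

Set Implicit Arguments.
Unset Strict Implicit.
Unset Printing Implicit Defensive.
Import Order.TTheory GRing.Theory Num.Theory numFieldNormedType.Exports.
Local Open Scope classical_set_scope.
Local Open Scope ring_scope.
Local Open Scope complex_scope.

(** * Sublinear functionals and the real Hahn-Banach theorem *)

Section Sublinear.
Context (R : realType) (X : lmodType R).
Implicit Types (p q : X -> R) (x y : X).

(** Homogeneity is stated as an inequality, the one that is easy to check for an
    infimum; applied to [t] and to [t^-1] it gives equality ([sublinearZ]). *)
Definition sublinear p :=
  (forall x y, p (x + y) <= p x + p y) /\
  (forall t x, 0 < t -> p (t *: x) <= t * p x).

Lemma sublinearZ p t x : sublinear p -> 0 < t -> p (t *: x) = t * p x.
Proof.
move=> [_ pZ] t0; apply/le_anti; rewrite pZ//=.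
rewrite -ler_pdivlMl// -{1}[x](@scalerK _ _ t) ?gt_eqF//.
by rewrite pZ// invr_gt0.
Qed.

Lemma sublinear0 p : sublinear p -> p 0 = 0.
Proof.
move=> ps; have := @sublinearZ p 2 0 ps; rewrite scaler0 => /(_ (ltr0n _ _)).
lra.
Qed.

Lemma sublinear_geN p x : sublinear p -> - p (- x) <= p x.
Proof.
move=> ps; have := ps.1 x (- x); rewrite subrr sublinear0//; lra.
Qed.

(** The common source of all sublinear functionals below: the distance to a
    subspace and the infimum along a ray, where [k] is a sum or a multiple of
    indices, and the infimum of a chain, where [k] is the index of the smaller
    of the two functionals. *)
Lemma sublinear_inf (I : Type) (S : set I) (g : I -> X -> R) :
  S !=set0 ->
  (forall x, has_lbound [set g i x | i in S]) ->
  (forall i j x y, S i -> S j ->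
     exists2 k, S k & g k (x + y) <= g i x + g j y) ->
  (forall t i x, 0 < t -> S i ->
     exists2 k, S k & g k (t *: x) <= t * g i x) ->
  sublinear (fun x => inf [set g i x | i in S]).
Proof.
move=> [i0 Si0] glb gD gZ.
have infle i x : S i -> inf [set g i x | i in S] <= g i x.
  by move=> Si; apply: ge_inf => //; exists i.
have leinf c x : (forall i, S i -> c <= g i x) ->
    c <= inf [set g i x | i in S].
  move=> cg; apply: lb_le_inf; first by exists (g i0 x), i0.
  by move=> _ [i Si <-]; exact: cg.
split=> [x y|t x t0].
  rewrite -lerBlDr; apply: (leinf) => i Si.
  rewrite lerBlDr -lerBlDl; apply: (leinf) => j Sj; rewrite lerBlDl.
  by have [k Sk] := gD i j x y Si Sj; apply: le_trans; exact: infle.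
rewrite -ler_pdivrMl//; apply: (leinf) => i Si; rewrite ler_pdivrMl//.
by have [k Sk] := gZ t i x t0 Si; apply: le_trans; exact: infle.
Qed.

(** The largest sublinear functional below [p] whose value at [- x] is at most
    [- p x]: any such [q] has [q y <= q (y + t x) + t q (- x)]. *)
Definition ray_inf p x y := inf [set p (y + t *: x) - t * p x | t in >= 0].

Lemma ray_inf_has_lbound p x y : sublinear p ->
  has_lbound [set p (y + t *: x) - t * p x | t in >= 0].
Proof.
move=> ps; exists (- p (- y)) => _ [t /= t0 <-].
have [->|tn0] := eqVneq t 0.
  by rewrite scale0r addr0 mul0r subr0 sublinear_geN.
have {}t0 : 0 < t by rewrite lt_neqAle eq_sym tn0.
have := ps.1 (y + t *: x) (- y); rewrite addrAC subrr add0r sublinearZ//; lra.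
Qed.

Lemma ray_inf_le p x y t : sublinear p -> 0 <= t ->
  ray_inf p x y <= p (y + t *: x) - t * p x.
Proof.
by move=> ps t0; apply: ge_inf; [exact: ray_inf_has_lbound|exists t].
Qed.

Lemma ray_inf_le0 p x y : sublinear p -> ray_inf p x y <= p y.
Proof.
move=> ps; have := ray_inf_le x y ps (lexx 0).
by rewrite scale0r addr0 mul0r subr0.
Qed.

Lemma ray_inf_le1 p x y : sublinear p -> ray_inf p x y <= p (y + x) - p x.
Proof.
by move=> ps; have := ray_inf_le x y ps ler01; rewrite scale1r mul1r.
Qed.

Lemma ray_inf_sublinear p x : sublinear p -> sublinear (ray_inf p x).
Proof.
move=> ps; apply: sublinear_inf => [|y|s t y z /= s0 t0|r t y r0 /= t0].
- by exists 0 => /=.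
- exact: ray_inf_has_lbound.
- exists (s + t); first exact: addr_ge0.
  have := ps.1 (y + s *: x) (z + t *: x).
  rewrite addrACA -scalerDl; lra.
- exists (r * t); first by rewrite mulr_ge0// ltW.
  by rewrite -scalerA -scalerDr sublinearZ// mulrBr mulrA.
Qed.

(** Zorn's lemma for the reversed pointwise order. A nonempty chain has an
    infimum because all sublinear functionals [q <= p] satisfy
    [- p (- x) <= - q (- x) <= q x]. *)
Lemma minimal_sublinear p : sublinear p ->
  exists q, [/\ sublinear q, forall x, q x <= p x &
    forall r, sublinear r -> (forall x, r x <= q x) -> forall x, q x <= r x].
Proof.
move=> ps.
pose T := {q : X -> R | sublinear q /\ forall x, q x <= p x}.
pose above : rel T := fun u v => `[< forall x, sval v x <= sval u x >].
have p0 : T by exists p.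
have [||C Ctot|[q [qs qp]] qmin] := @ZL_preorder T p0 above.
- by move=> u; apply/asboolP.
- move=> v u w /asboolP uv /asboolP wu; apply/asboolP => x.
  exact: le_trans (wu x) (uv x).
- have [->|/set0P[u0 Cu0]] := eqVneq C set0; first by exists p0.
  have Clb x : has_lbound [set sval u x | u in C].
    exists (- p (- x)) => _ [[q [qs qp]] Cq <-] /=.
    by rewrite (le_trans _ (sublinear_geN x qs))// lerN2.
  have infle u x : C u -> inf [set sval v x | v in C] <= sval u x.
    by move=> Cu; apply: ge_inf => //; exists u.
  have infs : sublinear (fun x => inf [set sval u x | u in C]).
    apply: sublinear_inf => // [|u v x y Cu Cv|t u x t0 Cu].
    + by exists u0.
    + have [/asboolP vu|/asboolP uv] := Ctot u v Cu Cv.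
      * exists v => //; rewrite (le_trans ((svalP v).1.1 x y))//.
        by rewrite lerD2r.
      * exists u => //; rewrite (le_trans ((svalP u).1.1 x y))//.
        by rewrite lerD2l.
    + by exists u => //; exact: (svalP u).1.2.
  have infp x : inf [set sval u x | u in C] <= p x.
    exact: le_trans (infle u0 x Cu0) ((svalP u0).2 x).
  pose w : T := exist _ (fun x => _) (conj infs infp).
  exists w => u Cu; by apply/asboolP => x /=; exact: infle.
exists q; split=> // r rs rq x.
have rp y : r y <= p y := le_trans (rq y) (qp y).
pose w : T := exist _ r (conj rs rp).
by apply/asboolP: x; apply: (qmin w); apply/asboolP.
Qed.

(** A minimal sublinear [f] lies below [ray_inf f y] for every [y], so that
    [f x <= f (x + y) - f y]; with subadditivity this makes [f] additive.
    Minimality is taken below [ray_inf p x0] instead of [p] in order to have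
    [f (- x0) <= - p x0], that is, equality at [x0]. *)
Theorem hahn_banach p x0 : sublinear p ->
  exists f : X -> R, [/\ linear (f : X -> R^o), forall x, f x <= p x &
    f x0 = p x0].
Proof.
move=> ps; have [f [fs fp fmin]] := minimal_sublinear (ray_inf_sublinear x0 ps).
have fle x : f x <= p x by rewrite (le_trans (fp x))// ray_inf_le0.
have fD x y : f (x + y) = f x + f y.
  apply/le_anti; rewrite fs.1/= addrC.
  have := fmin _ (ray_inf_sublinear y fs) (fun z => ray_inf_le0 y z fs) x.
  by move=> /le_trans /(_ (ray_inf_le1 y x fs)); rewrite lerBrDr addrC.
have fN x : f (- x) = - f x.
  by have := fD x (- x); rewrite subrr sublinear0//; lra.
exists f; split=> // [k x y|].
  rewrite fD; congr (_ + _); have [k0|k0|->] := ltgtP k 0.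
  - by rewrite -[k]opprK scaleNr fN sublinearZ ?oppr_gt0// mulNr !opprK.
  - by rewrite sublinearZ.
  - by rewrite !scale0r sublinear0.
apply/le_anti; rewrite fle/=.
have := le_trans (fp (- x0)) (ray_inf_le1 x0 (- x0) ps).
by rewrite fN addNr sublinear0//; lra.
Qed.

End Sublinear.

(** * Passing between real and complex scalars *)

(** A separate name for the carrier, on which [R] acts through [R[i]]. *)
Definition real_restriction (R : realType) (X : lmodType R[i]) : Type := X.

Section RealRestriction.
Context (R : realType) (X : lmodType R[i]).
Local Notation XR := (real_restriction X).

HB.instance Definition _ := GRing.Zmodule.on XR.

Definition real_scale (t : R) (x : XR) : XR := (t%:C *: (x : X))%R.

Fact real_scaleA s t x : real_scale s (real_scale t x) = real_scale (s * t) x.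
Proof. by rewrite /real_scale scalerA -rmorphM. Qed.

Fact real_scale1 : left_id 1 real_scale.
Proof. by move=> x; rewrite /real_scale scale1r. Qed.

Fact real_scaleDr : right_distributive real_scale +%R.
Proof. by move=> t x y; exact: scalerDr. Qed.

Fact real_scaleDl x : {morph real_scale^~ x : s t / s + t}.
Proof. by move=> s t; rewrite /real_scale rmorphD scalerDl. Qed.

HB.instance Definition _ := GRing.Zmodule_isLmodule.Build R XR
  real_scaleA real_scale1 real_scaleDr real_scaleDl.

Lemma real_restriction_scaleE (t : R) (x : XR) : t *: x = t%:C *: (x : X) :> X.
Proof. by []. Qed.

End RealRestriction.

Section Complexification.
Context (R : realType) (X : lmodType R[i]) (f : X -> R).
Hypothesis fl : linear (f : real_restriction X -> R^o).

(** The only candidate for a complex-linear functional with real part [f]: its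
    imaginary part at [x] must be minus its real part at [i x]. *)
Definition complexify (x : X) : R[i]^o := f x +i* - f ('i *: x).

Lemma complexify_linear : linear complexify.
Proof.
have fD x y : f (x + y) = f x + f y.
  by have := fl 1 x y; rewrite !scale1r.
have fZ t x : f (t%:C *: x) = t * f x.
  have f0 : f 0 = 0 by have := fD 0 0; rewrite addr0; lra.
  by have := fl t x 0; rewrite f0 !addr0.
move=> [a b] x y; rewrite /complexify.
have kE z : (a +i* b) *: z = a%:C *: z + b%:C *: ('i *: z) :> X.
  by rewrite scalerA -scalerDl; congr (_ *: _); simpc.
have ikE z : 'i *: ((a +i* b) *: z) = a%:C *: ('i *: z) + (- b)%:C *: z :> X.
  by rewrite !scalerA -scalerDl; congr (_ *: _); simpc.
rewrite scalerDr ikE kE !fD !fZ.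
by apply/eqP; rewrite eq_complex/=; apply/andP; split; apply/eqP; ring.
Qed.

End Complexification.

(** * Density of subspaces through the dual *)

Section DenseSubspace.
Context (R : realType) (X : normedModType R[i]) (V : set X).

Lemma real_normE (x : X) : (complex.Re `|x|)%:C = `|x|.
Proof. by rewrite RRe_real// normr_real. Qed.

Definition subspace_dist (x : X) : R :=
  inf [set complex.Re `|x - v| | v in V].

Lemma subspace_dist_has_lbound x :
  has_lbound [set complex.Re `|x - v| | v in V].
Proof.
by exists 0 => _ [v _ <-]; rewrite -lecR real_normE; exact: normr_ge0.
Qed.

Lemma subspace_dist_le x v : V v -> subspace_dist x <= complex.Re `|x - v|.
Proof.
by move=> Vv; apply: ge_inf; [exact: subspace_dist_has_lbound|exists v].
Qed.

Hypotheses (V0 : V 0)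
  (VP : forall (k : R[i]) v w, V v -> V w -> V (k *: v + w)).

Lemma subspace_dist_sublinear :
  sublinear (subspace_dist : real_restriction X -> R).
Proof.
apply: sublinear_inf => [|x|v w x y Vv Vw|t v x t0 Vv].
- by exists 0.
- exact: subspace_dist_has_lbound.
- exists (v + w); first by rewrite -[v]scale1r; exact: VP.
  by rewrite -lecR rmorphD/= !real_normE opprD addrACA ler_normD.
- exists (t%:C *: v); first by rewrite -[_ *: v]addr0; exact: VP.
  rewrite -lecR rmorphM/= !real_normE real_restriction_scaleE -scalerBr normrZ.
  by rewrite ger0_norm// lecR ltW.
Qed.

(** If [V] misses a ball around [x0], then the distance to [V] is positive at
    [x0]. A real functional dominated by the distance vanishes on [V] and, the
    distance being at most the norm, is bounded; attaining the distance at [x0]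
    makes it nonzero. *)
Theorem dense_of_dual_separation :
  (forall F : dual X, (forall v, V v -> F v = 0) -> F = 0) -> dense V.
Proof.
move=> Vsep; apply: contrapT => /existsNP[O /not_implyP[[x0 Ox0]]].
move=> /not_implyP[Oop /set0P/negP/negPn/eqP OV0].
have [e /= e0 xO] : exists2 e : R[i], 0 < e & ball x0 e `<=` O.
  by have /nbhs_ballP := open_nbhs_nbhs (conj Oop Ox0).
have dx0 : 0 < subspace_dist x0.
  have e0R : 0 < complex.Re e by rewrite -ltcR RRe_real// gtr0_real.
  apply: lt_le_trans e0R _; apply: lb_le_inf.
    by exists (complex.Re `|x0 - 0|), 0.
  move=> _ [v Vv <-]; rewrite -lecR real_normE RRe_real ?gtr0_real//.
  rewrite real_leNgt ?(gtr0_real e0) ?normr_real//; apply/negP => xv.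
  suff : (O `&` V) v by rewrite OV0.
  by split=> //; apply: xO; rewrite -ball_normE.
have [f [fl fd fx0]] :=
  hahn_banach (x0 : real_restriction X) subspace_dist_sublinear.
have fN x : f (- x) = - f x.
  have f0 : f 0 = 0 by have := fl 1 0 0; rewrite scale1r addr0/= scale1r; lra.
  have := fl (-1) x 0; rewrite f0 !addr0 [_ *: (f x : R^o)]mulN1r => <-.
  by congr f; rewrite real_restriction_scaleE rmorphN1 scaleN1r.
have fle x : (`|f x|)%:C <= `|x|.
  have fnorm y : f y <= complex.Re `|y|.
    by rewrite (le_trans (fd y))// -{2}[y]subr0 subspace_dist_le.
  rewrite -real_normE lecR ler_norml fnorm andbT lerNl -fN.
  by rewrite (le_trans (fnorm _))// normrN.
(* The constant [2] accounts for the real and the imaginary part. *)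
have fM x : `|complexify f x| <= 2 * `|x|.
  rewrite (le_trans (norm_le_ReIm _))//= normrN rmorphD/= mulr_natl mulr2n.
  rewrite lerD// (le_trans (fle _))// normrZ.
  by rewrite normc_def/= expr0n expr1n add0r sqrtr1 mul1r.
have fV v : V v -> f v = 0.
  have fV_le w : V w -> f w <= 0.
    move=> Vw; rewrite (le_trans (fd w))// (le_trans (subspace_dist_le w Vw))//.
    by rewrite subrr normr0.
  move=> Vv; apply/le_anti; rewrite fV_le//= -oppr_le0 -fN fV_le//.
  by rewrite -scaleN1r -[_ *: _]addr0; exact: VP.
have FV v : V v -> mkdual (complexify_linear fl) fM v = 0.
  move=> Vv; rewrite mkdualE /complexify !fV ?oppr0//.
  by rewrite -[_ *: _]addr0; exact: VP.
have /(congr1 (fun F : dual X => complex.Re (F x0))) := Vsep _ FV.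
by rewrite dual0E mkdualE/= fx0 => dx00; rewrite dx00 ltxx in dx0.
Qed.

End DenseSubspace.

(** * Functionals vanishing on products *)

Section Annihilator.
Context (R : realType) (A : banachAlgType R[i]) (F : dual A).
Hypothesis F_mul0 : forall a b, F (a ** b) = 0.

Definition rank_one (a : A) : dual A := F a *: F.

Fact rank_one_linear : linear rank_one.
Proof. by move=> k a b; rewrite /rank_one linearP scalerDl scalerA. Qed.

HB.instance Definition _ := GRing.isLinear.Build _ _ _ _
  rank_one rank_one_linear.

Lemma rank_one_continuous : continuous rank_one.
Proof. by move=> a; apply: cvgZr_tmp; exact: dual_continuous. Qed.

Lemma rank_one_derivation : derivation rank_one.
Proof.
move=> a b; rewrite /= /rank_one F_mul0 scale0r; apply: dualP => c.
by rewrite dual0E dualDE !mkdualE !dualZE !F_mul0 !scaler0 addr0.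
Qed.

(** Cyclicity of [rank_one] at the pair [(a, a)] reads [2 * F a ^ 2 = 0]. *)
Lemma cyclically_weakly_amenable_annihilator :
  cyclically_weakly_amenable A -> F = 0.
Proof.
move=> /(_ _ rank_one_continuous rank_one_derivation) cyc.
apply: dualP => a; have /eqP := cyc a a.
by rewrite -mulr2n mulrn_eq0/= mulf_eq0 orbb => /eqP.
Qed.

End Annihilator.

Lemma essential_of_annihilator (R : realType) (A : banachAlgType R[i]) :
  (forall F : dual A, (forall a b, F (a ** b) = 0) -> F = 0) -> essential A.
Proof.
move=> Aann; apply: dense_of_dual_separation => [|k x y|F FV].
- by exists 0, (fun=> 0), (fun=> 0), (fun=> 0); rewrite big_ord0.
- move=> [m [c [a [b ->]]]] [n [c' [a' [b' ->]]]].
  pose cat T (u : 'I_m -> T) (v : 'I_n -> T) i :=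
    match fintype.split i with inl j => u j | inr j => v j end.
  exists (m + n)%N, (cat _ (fun i => k * c i) c'), (cat _ a a'), (cat _ b b').
  rewrite big_split_ord/= scaler_sumr; congr (_ + _); apply: eq_bigr => i _.
  + by rewrite /cat (unsplitK (inl i)) scalerA.
  + by rewrite /cat (unsplitK (inr i)).
- apply: Aann => a b; apply: FV.
  exists 1, (fun=> 1), (fun=> a), (fun=> b).
  by rewrite big_ord1 scale1r.
Qed.

(** * Evaluation functionals and the second dual *)

Section Evaluation.
Context (R : realType) (X : normedModType R[i]).

Fact dual_eval_linear (x : X) : linear (fun F : dual X => F x : R[i]^o).
Proof. by []. Qed.

Fact dual_eval_bound (x : X) (F : dual X) : `|F x| <= `|x| * `|F|.
Proof. by rewrite mulrC ler_dual. Qed.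

Definition dual_eval (x : X) : dual (dual X) :=
  mkdual (dual_eval_linear x) (dual_eval_bound x).

End Evaluation.

Theorem proposition2p3 (R : realType) (A : banachAlgType R[i]) :
  (cyclically_weakly_amenable A -> essential A) /\
  (cyclically_weakly_amenable (bidual A) -> essential A).
Proof.
split=> cwa; apply: essential_of_annihilator => F F_mul0.
  exact: cyclically_weakly_amenable_annihilator cwa.
pose evF : dual (bidual A) := dual_eval F.
have ev_mul0 (Phi Psi : bidual A) : evF (Phi ** Psi) = 0.
  rewrite mkdualE [LHS]mkdualE (_ : arens_act Psi F = 0) ?linear0//.
  apply: dualP => a; rewrite mkdualE (_ : dual_actr F a = 0) ?linear0//.
  by apply: dualP => b; rewrite mkdualE F_mul0.
have ev0 := cyclically_weakly_amenable_annihilator ev_mul0 cwa.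
apply: dualP => a.
exact: (congr1 (fun G : dual (bidual A) => G (dual_eval a)) ev0).
Qed.
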